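(* Let $\mathbf{X}$ be an omnioriented quasitoric orbifold given by a combinatorial model $(P,N,\{\lambda_i\})$ with $\dim P=n$. If the stable almost complex structure of $\mathbf{X}$ determined by the omniorientation admits a reduction to an almost complex structure on $\mathbf{X}$, then, with $\mathbf{X}$ oriented according to the almost complex structure (and orientations of $P$ and $N$ chosen to induce this orientation), $\sigma(v)=\det\Lambda_{(v)}$ is positive for each vertex $v$ of $P$.
   Context: Quasitoric orbifolds. For a free $\mathbb{Z}$-module $M$ of finite rank, $M_R=M\otimes_{\mathbb{Z}}\mathbb{R}$ and $T_M=M_R/M$. A combinatorial model $(P,N,\{\lambda_i\})$ consists of a simple polytope $P\subset\mathbb{R}^n$ of dimension $n$ with facets $F_i$, $i\in I=\{1,\dots,m\}$, a free $\mathbb{Z}$-module $N$ of rank $n$, and vectors $\lambda_i\in N$ such that $\lambda_{i_1},\dots,\lambda_{i_k}$ are linearly independent over $\mathbb{Z}$ whenever $F_{i_1}\cap\dots\cap F_{i_k}\neq\emptyset$. For a proper face $F$, $I(F)=\{i:F\subset F_i\}$, $N(F)$ is generated by $\{\lambda_j:j\in I(F)\}$, $\xi_{N(F)}:T_{N(F)}\to T_N$ is induced by inclusion, $T_{N(P)}=1$. The quasitoric orbifold $\mathbf{X}$ has underlying space $X=P\times T_N/\sim$, where $(p,t)\sim(q,s)$ iff $p=q$ and $s^{-1}t\in\mathrm{im}\,\xi_{N(F)}$, $F$ the face whose relative interior contains $p$; $\pi:X\to P$ is the projection. Orbifold charts: for a vertex $v$, $U_v$ is the complement in $P$ of the facets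 not containing $v$, $W_v=U_v\times T_{N(v)}/\sim_v$ (with $(p,t)\sim_v(q,s)$ iff $p=q$ and $s^{-1}t\in T_{N(F)}\subset T_{N(v)}$), which is equivariantly an open ball in $\mathbb{C}^n$ via the basis $\{\lambda_i\}_{i\in I(v)}$ of $N(v)$; the finite group $G_v=N/N(v)=\ker\xi_{N(v)}$ acts and $\xi_{N(v)}$ induces $W_v/G_v\cong\pi^{-1}(U_v)$. An omniorientation is a definite choice of sign of each $\lambda_i$ (then called dicharacteristic vectors). Stable almost complex structure. $\widehat{N}\subset N$ is generated by all $\lambda_i$; $\mathbf{O}$ is the quasitoric orbifold of $(P,\widehat{N},\{\lambda_i\})$, on which $N/\widehat{N}\subset T_{\widehat{N}}$ acts with quotient $\mathbf{X}$. Let $L=\mathbb{Z}^m$, $\Lambda:L\to\widehat{N}$, $e_i\mapsto\lambda_i$, $K=\ker\Lambda$, so $T_K\subset T_L=U(1)^m$ and $T_L/T_K\cong T_{\widehat{N}}$. Let $d_{\mathcal{F}}:P\to\mathbb{R}^m$ have $i$-th coordinate the Euclidean distance to the hyperplane of $F_i$, $V_P$ the $n$-dimensional linear subspace parallel to $d_{\mathcal{F}}(P)$, $V_P^\perp$ its orthogonal complement. $W(P)\subset\mathbb{C}^m$ is the open set of $z$ for which the facets $F_i$ with $z_i=0$ have nonempty intersection (empty collection allowed). $\widehat{H}=T_K\times\exp(V_P^\perp)\subset(\mathbb{C}^* )^m$ acts on $W(P)$ coordinatewise and $\mathbf{O}=W(P)/\widehat{H}$. The coordinate splitting $\mathcal{T}W(P)=\bigoplus_iC_{F_i}$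 descends to complex orbifold line bundles $\widehat{\nu}(F_i)=C_{F_i}/\widehat{H}$ on $\mathbf{O}$ and $\nu(F_i)=\widehat{\nu}(F_i)/(N/\widehat{N})$ on $\mathbf{X}$, and there is an isomorphism of real orbifold bundles $\mathcal{T}\mathbf{X}\oplus\mathfrak{h}\cong\mathfrak{W}=\bigoplus_{i=1}^m\nu(F_i)$ with $\mathfrak{h}$ a trivial real bundle of rank $2(m-n)$. The complex structure on $\mathfrak{W}$ is the stable almost complex structure. It admits a reduction to an almost complex structure if $\mathcal{T}\mathbf{X}$ has a complex structure $J$ such that $(\mathcal{T}\mathbf{X},J)$ plus a trivial complex bundle of rank $m-n$ is isomorphic, as a complex orbifold bundle, to $\mathfrak{W}$ compatibly with the splitting $\mathfrak{W}\cong\mathcal{T}\mathbf{X}\oplus\mathfrak{h}$ of real orbifold bundles. Orientation and ordering. Given orientations of $\mathbb{R}^n\supset P$ and of $N$, $\mathbf{X}$ is oriented so that, over the interior of $P$ (where $X$ is $P^{\circ}\times T_N$), if $u_1,\dots,u_n$ is a positively oriented basis of $\mathbb{R}^n$ and $a_1,\dots,a_n$ is a positively oriented basis of $N_R$, then $u_1,a_1,\dots,u_n,a_n$ is positively oriented. For a vertex $v=F_{i_1}\cap\dots\cap F_{i_n}$, let $E_k$ be the unique edge of $P$ with $F_{i_k}\cap E_k=v$ and $e_k$ a vector along $E_k$ with origin $v$; the order $F_{i_1},\dots,F_{i_n}$ is chosen so that $e_1,\dots,e_n$ is positively oriented. $\Lambda_{(v)}=[\lambda_{i_1}\ \dots\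 \lambda_{i_n}]$, the columns being coordinates in a positively oriented $\mathbb{Z}$-basis of $N$. *)

(* Defs.v *)
(* MathComp / MathComp-Analysis; the complex numbers are R[i] from
   mathcomp-real-closed. *)
From HB Require Import structures.
From mathcomp Require Import all_boot all_order all_algebra.
From mathcomp Require Import all_classical all_reals all_analysis.
From mathcomp Require Import complex.

Set Implicit Arguments.
Unset Strict Implicit.
Unset Printing Implicit Defensive.

Import Order.TTheory GRing.Theory Num.Theory numFieldNormedType.Exports.

Local Open Scope classical_set_scope.
Local Open Scope ring_scope.

(* R[i] packed as a numFieldType, which gives it (and the spaces of matrices
   over it) the topology of MathComp-Analysis. *)
Definition Cplx (R : realType) : numFieldType := R[i].

Definition ofReal (R : realType) (a : R) : Cplx R := (a%:C)%C.

Definition imI (R : realType) : Cplx R := ('i)%C.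

Definition cis (R : realType) (t : R) : Cplx R := (cos t +i* sin t)%C.

(* An orientation of R^n or Z^n is a sign relative to the standard basis; the
   columns of [u] are the vectors of a basis. *)
Definition positive_basis (K : numDomainType) (n : nat) (o : bool)
  (u : 'M[K]_n) : Prop := 0 < (-1) ^+ o * \det u.

Section Polytope.
Context (R : realType) (n m : nat).

(* [facet_dist a c x] is d_F(x): the columns of [a] are the inward normals of
   the facets, of length 1, so that the i-th coordinate is the signed distance
   to the hyperplane of F_i, nonnegative on P. *)
Definition facet_dist (a : 'M[R]_(n, m)) (c : 'cV[R]_m) (x : 'cV[R]_n) :
  'cV[R]_m := a^T *m x + c.

Definition halfspaces (a : 'M[R]_(n, m)) (c : 'cV[R]_m) : set 'cV[R]_n :=
  [set x | forall i, 0 <= facet_dist a c x i ord0].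

Definition extreme_point (A : set 'cV[R]_n) (v : 'cV[R]_n) : Prop :=
  A v /\ forall x y, A x -> A y -> v = 2^-1 *: (x + y) -> x = y.

Record simple_polytope := SimplePolytope {
  normal : 'M[R]_(n, m);
  offset : 'cV[R]_m;
  normal_unit : forall i, ((col i normal)^T *m col i normal) ord0 ord0 = 1;
  polytope_bounded : bounded_set (halfspaces normal offset);
  polytope_fulldim : exists x, forall i, 0 < facet_dist normal offset x i ord0;
  (* each inequality defines a facet, and different indices different facets *)
  polytope_facets : forall i, exists x, facet_dist normal offset x i ord0 = 0 /\
    forall j, j != i -> 0 < facet_dist normal offset x j ord0;
  polytope_simple : forall v, extreme_point (halfspaces normal offset) v ->
    #|[set i | facet_dist normal offset v i ord0 == 0]%SET| = n }.

Definition dF (P : simple_polytope) : 'cV[R]_n -> 'cV[R]_m :=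
  facet_dist (normal P) (offset P).

Definition polytope (P : simple_polytope) : set 'cV[R]_n :=
  halfspaces (normal P) (offset P).

Definition facet (P : simple_polytope) (i : 'I_m) : set 'cV[R]_n :=
  [set x | polytope P x /\ dF P x i ord0 = 0].

Definition face (P : simple_polytope) (S : {set 'I_m}) : set 'cV[R]_n :=
  [set x | polytope P x /\ forall i, i \in S -> facet P i x].

Definition vertex (P : simple_polytope) : 'cV[R]_n -> Prop :=
  extreme_point (polytope P).

Definition edge (P : simple_polytope) (E : set 'cV[R]_n) : Prop :=
  (exists S, E = face P S) /\
  exists x e, [/\ e != 0, E x, E (x + e) &
    forall y, E y -> exists t : R, y = x + t *: e].

(* The orthogonal complement of V_P = { a^T u | u in R^n }. *)
Definition VPperp (P : simple_polytope) : set 'cV[R]_m :=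
  [set w | forall u : 'cV[R]_n, ((normal P)^T *m u)^T *m w = 0].

End Polytope.

(* N is Z^n, through a choice of basis; lambda_i is the i-th column of
   [lambda]. The signs of the columns are the omniorientation. *)
Record model (R : realType) (n m : nat) := Model {
  base : simple_polytope R n m;
  lambda : 'M[int]_(n, m);
  lambda_indep : forall S : {set 'I_m}, face base S !=set0 ->
    forall c : 'I_m -> int, \sum_(i in S) c i *: col i lambda = 0 ->
    forall i, i \in S -> c i = 0 }.

Section QuasitoricOrbifold.
Context (R : realType) (n m : nat) (X : model R n m).
Let P := base X.
Let C := Cplx R.

Definition lambdaR : 'M[R]_(n, m) := map_mx intr (lambda X).

Definition WP : set 'cV[C]_m :=
  [set z | exists x, polytope P x /\ forall i, z i ord0 = 0 -> facet P i x].

Definition act (g z : 'cV[C]_m) : 'cV[C]_m :=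
  \col_i (g i ord0 * z i ord0).

(* As O = W(P) / (T_K x exp(V_P^perp)) and X = O / (N / \hat N), the orbifold X
   is the quotient of W(P) by H = T' x exp(V_P^perp), where T' is the preimage
   in T_L of N / \hat N < T_L / T_K = T_{\hat N}, i.e. the kernel of
   T_L -> T_N: the class of b in R^m is in T' when Lambda_R b is in N.
   Orbifold bundles on X are H-equivariant bundles on W(P). *)
Definition H : set 'cV[C]_m :=
  [set g | exists b w : 'cV[R]_m,
    [/\ lambdaR *m b \is a mxOver Num.int, VPperp P w &
      g = \col_i (cis (2 * pi * b i ord0) * ofReal (expR (w i ord0)))]].

(* The tangent space at z of the H-orbit; Lie(H) = K_R + V_P^perp. The tangent
   bundle TX is the quotient of the tangent bundle W(P) x C^m by [vert], with
   the action (z, w) |-> (g z, g w); a bundle map out of TX is one out of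
   W(P) x C^m vanishing on [vert]. *)
Definition vert (z : 'cV[C]_m) : set 'cV[C]_m :=
  [set y | exists k w : 'cV[R]_m,
    [/\ lambdaR *m k = 0, VPperp P w &
      y = \col_i (z i ord0 *
        (ofReal (w i ord0) + imI R * ofReal (2 * pi * k i ord0)))]].

(* An almost complex structure on X: an H-equivariant endomorphism of square -1
   of TX, given through a lift to W(P) x C^m. *)
Record almost_complex (J : 'cV[C]_m -> 'cV[C]_m -> 'cV[C]_m) : Prop := {
  ac_cont : {within WP `*` setT,
    continuous (fun x : 'cV[C]_m * 'cV[C]_m => J x.1 x.2)};
  ac_linear : forall z (a : R) w w', WP z ->
    J z (ofReal a *: w + w') = ofReal a *: J z w + J z w';
  ac_vert : forall z w, WP z -> vert z w -> vert z (J z w);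
  ac_square : forall z w, WP z -> vert z (J z (J z w) + w);
  ac_equiv : forall g z w, H g -> WP z ->
    vert (act g z) (J (act g z) (act g w) - act g (J z w)) }.

(* Isomorphisms of real orbifold bundles from the sum of TX and the trivial
   bundle of fibre E to \mathfrak{W}, the sum of the nu(F_i), which is
   W(P) x C^m with H acting coordinatewise. The map [r] is the inclusion of the
   reals into the scalars of E. *)
Record tangent_sum_iso (K : numFieldType) (E : normedModType K) (r : R -> K)
  (Theta : 'cV[C]_m -> 'cV[C]_m -> E -> 'cV[C]_m) : Prop := {
  ts_cont : {within (WP `*` setT) `*` setT,
    continuous (fun x : 'cV[C]_m * 'cV[C]_m * E => Theta x.1.1 x.1.2 x.2)};
  ts_linear : forall z (a : R) w w' e e', WP z ->
    Theta z (ofReal a *: w + w') (r a *: e + e') =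
    ofReal a *: Theta z w e + Theta z w' e';
  ts_equiv : forall g z w e, H g -> WP z ->
    Theta (act g z) (act g w) e = act g (Theta z w e);
  ts_ker : forall z w e, WP z -> Theta z w e = 0 <-> vert z w /\ e = 0;
  ts_surj : forall z y, WP z -> exists w e, Theta z w e = y }.

(* Isomorphisms from the trivial complex bundle of rank m - n to the trivial
   real bundle h of rank 2 (m - n). *)
Record trivial_iso
  (phi : 'cV[C]_m -> 'cV[C]_(m - n) -> 'cV[R]_((m - n).*2)) : Prop := {
  ti_cont : {within WP `*` setT,
    continuous (fun x : 'cV[C]_m * 'cV[C]_(m - n) => phi x.1 x.2)};
  ti_linear : forall z (a : R) c c', WP z ->
    phi z (ofReal a *: c + c') = a *: phi z c + phi z c';
  ti_equiv : forall g z c, H g -> WP z -> phi (act g z) c = phi z c;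
  ti_bij : forall z, WP z -> bijective (phi z) }.

(* \mathfrak{W} is TW(P) / H, which projects onto TX; an isomorphism
   TX + h -> \mathfrak{W} is a splitting when it is on TX a section of this
   projection. *)
Definition real_splitting
  (Theta : 'cV[C]_m -> 'cV[C]_m -> 'cV[R]_((m - n).*2) -> 'cV[C]_m) : Prop :=
  tangent_sum_iso (fun a : R => a) Theta /\
  forall z w, WP z -> vert z (Theta z w 0 - w).

Definition complex_iso (J : 'cV[C]_m -> 'cV[C]_m -> 'cV[C]_m)
  (Phi : 'cV[C]_m -> 'cV[C]_m -> 'cV[C]_(m - n) -> 'cV[C]_m) : Prop :=
  tangent_sum_iso (@ofReal R) Phi /\
  forall z w c, WP z -> Phi z (J z w) (imI R *: c) = imI R *: Phi z w c.

Definition compatible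
  (Theta : 'cV[C]_m -> 'cV[C]_m -> 'cV[R]_((m - n).*2) -> 'cV[C]_m)
  (Phi : 'cV[C]_m -> 'cV[C]_m -> 'cV[C]_(m - n) -> 'cV[C]_m) : Prop :=
  exists2 phi, trivial_iso phi &
    forall z w c, WP z -> Phi z w c = Theta z w (phi z c).

(* The stable almost complex structure reduces to J. *)
Definition reduces_to (J : 'cV[C]_m -> 'cV[C]_m -> 'cV[C]_m) : Prop :=
  almost_complex J /\
  exists Theta Phi,
    [/\ real_splitting Theta, complex_iso J Phi & compatible Theta Phi].

Lemma half_lt_ord (k : 'I_n.*2) : (k./2 < n)%N.
Proof. by rewrite ltn_half_double. Qed.

(* x_1, y_1, ..., x_n, y_n *)
Definition interleave (x y : 'I_n -> 'cV[C]_m) (k : 'I_n.*2) : 'cV[C]_m :=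
  if odd k then y (Ordinal (half_lt_ord k)) else x (Ordinal (half_lt_ord k)).

(* The classes of the vectors e_j form a real basis of T_zX = C^m / vert z. *)
Definition tangent_basis (z : 'cV[C]_m) (e : 'I_n.*2 -> 'cV[C]_m) : Prop :=
  (forall w, exists c : 'I_n.*2 -> R,
     vert z (w - \sum_j ofReal (c j) *: e j)) /\
  (forall c : 'I_n.*2 -> R,
     vert z (\sum_j ofReal (c j) *: e j) -> forall j, c j = 0).

Definition J_positive (J : 'cV[C]_m -> 'cV[C]_m -> 'cV[C]_m) (z : 'cV[C]_m)
  (x : 'I_n.*2 -> 'cV[C]_m) : Prop :=
  exists (w : 'I_n -> 'cV[C]_m) (M : 'M[R]_n.*2),
    let e := interleave w (fun k => J z (w k)) in
    [/\ tangent_basis z e,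
        forall j, vert z (x j - \sum_i ofReal (M i j) *: e i) & 0 < \det M].

(* Over the interior of P, the identification of P^o x T_N with an open subset
   of X = W(P) / H sends (p, class of Lambda_R b) to the orbit of
   (d_i(p) exp(2 pi sqrt(-1) b_i))_i. The differential of this map in the
   direction u of R^n, and in the direction Lambda_R s of N_R: *)
Definition int_point (p : 'cV[R]_n) (b : 'cV[R]_m) : 'cV[C]_m :=
  \col_i (ofReal (dF P p i ord0) * cis (2 * pi * b i ord0)).

Definition dir_polytope (b : 'cV[R]_m) (u : 'cV[R]_n) : 'cV[C]_m :=
  \col_i (ofReal (((normal P)^T *m u) i ord0) * cis (2 * pi * b i ord0)).

Definition dir_torus (p : 'cV[R]_n) (b s : 'cV[R]_m) : 'cV[C]_m :=
  \col_i (imI R * ofReal (2 * pi * s i ord0) * int_point p b i ord0).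

(* The orientation of X given by the orientations oP of R^n and oN of N is the
   one given by J. The columns of [s] are lifts to R^m of a basis of N_R. *)
Definition induces (oP oN : bool)
  (J : 'cV[C]_m -> 'cV[C]_m -> 'cV[C]_m) : Prop :=
  forall (p : 'cV[R]_n) (b : 'cV[R]_m) (u : 'M[R]_n) (s : 'M[R]_(m, n)),
    (forall i, 0 < dF P p i ord0) ->
    positive_basis oP u -> positive_basis oN (lambdaR *m s) ->
    J_positive J (int_point p b)
      (interleave (fun k => dir_polytope b (col k u))
                  (fun k => dir_torus p b (col k s))).

(* F_{i_1}, ..., F_{i_n} are the facets through v, in an order for which the
   basis e_1, ..., e_n (the columns of [e]) is positively oriented. *)
Definition positive_order (oP : bool) (v : 'cV[R]_n) (i : 'I_n -> 'I_m) :
  Prop :=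
  [/\ injective i, forall j, facet P j v <-> exists k, i k = j &
    exists e : 'M[R]_n, positive_basis oP e /\
      forall k, exists E, [/\ edge P E, facet P (i k) `&` E = [set v],
        col k e != 0 & E (v + col k e)]].

(* Lambda_(v), in the coordinates of the basis of N given by the columns of
   [B]. *)
Definition Lambda_v (B : 'M[int]_n) (i : 'I_n -> 'I_m) : 'M[int]_n :=
  invmx B *m \matrix_(j, k) lambda X j (i k).

End QuasitoricOrbifold.

(* Main.v *)
Require Import Defs.
From HB Require Import structures.
From mathcomp Require Import all_boot all_order all_algebra.
From mathcomp Require Import all_classical all_reals all_analysis.
From mathcomp Require Import perm complex ring.
Set Implicit Arguments.
Unset Strict Implicit.
Unset Printing Implicit Defensive.
Import Order.TTheory GRing.Theory Num.Theory numFieldNormedType.Exports.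
Local Open Scope classical_set_scope.
Local Open Scope ring_scope.

(** The point is that a reduction J is forced, over a vertex v, to be the
    standard complex structure of the sum of the nu(F_i), F_i through v.

    Write theta_z(w) = Phi_z(w, 0) for the restriction to TX of the complex
    isomorphism Phi. It kills the vectors tangent to the orbit, intertwines J_z
    with multiplication by sqrt(-1), and, because Phi is compatible with a
    splitting, is the identity modulo vectors tangent to the orbit
    ([lift_vert], [lift_J], [lift_section]). Let q be the projection of C^m to
    the n coordinates whose facets contain v. If z lies over v then these
    coordinates of z vanish, so q vanishes on the tangent space of the orbit and
    q theta_z = q. By continuity q theta_z is close to q at points z over the
    interior of P that are near v.

    Let L be the matrix of the lambda_(i_k), B a positive basis of N and
    D = L^-1 B; it has to be shown that det D > 0. Near v, take in T_zX the
    vectors x_k in the directions of the edges E_k and y_k in the directions of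
    the columns of B = L D. The frame (x, y) is obtained from the frame of the
    x_k and of sqrt(-1) times the i_k-th coordinate vectors by diag(1, D) and
    positive factors ([dir_block]). The image of the latter frame under
    q theta_z tends to a positive frame of C^n when z tends to a point over v,
    since the edge vectors are dual to the normals at v up to positive factors
    ([det_edges_gt0], [frame_det_edge], [cvg_frame_det]). On the other hand
    (x, y) comes from a frame (w, J w) by a matrix of positive determinant, and
    the image (F, sqrt(-1) F) of (w, J w) in C^n has determinant |det F|^2 >= 0
    ([frame_det_complex]). Hence det D >= 0 ([torus_orientation]), and det D is
    not 0 because the lambda_(i_k) are independent ([det_lambda_neq0]). *)

(** * Real determinants of frames of complex vectors *)

Section WithConj.
Context (K : fieldType) (cj : {rmorphism K -> K}) (n : nat).

(** The 2n columns of Q are vectors of C^n, seen as a real vector space of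
    dimension 2n; the coordinates (u, conj u) are, up to a fixed complex change
    of basis, the real coordinates (Re u, Im u). *)
Definition with_conj (Q : 'M[K]_(n, n + n)) : 'M[K]_(n + n) :=
  col_mx Q (map_mx cj Q).

Lemma with_conj_mul Q (M : 'M[K]_(n + n)) :
  map_mx cj M = M -> with_conj (Q *m M) = with_conj Q *m M.
Proof. by move=> cM; rewrite /with_conj map_mxM cM mul_col_mx. Qed.

Lemma det_one_conj (c : K) :
  \det (block_mx (1%:M : 'M[K]_n) c%:M 1%:M (cj c)%:M) = (cj c - c) ^+ n.
Proof.
have -> : block_mx (1%:M : 'M[K]_n) c%:M 1%:M (cj c)%:M =
    block_mx 1%:M 0 1%:M 1%:M *m block_mx 1%:M c%:M 0 (cj c - c)%:M.
  rewrite mulmx_block !mul1mx !mul0mx !addr0.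
  by rewrite -raddfD /= addrC subrK.
by rewrite det_mulmx det_lblock det_ublock !det_scalar !expr1n !mul1r.
Qed.

(** A frame (F, c F) comes from (1, c) by F on the first n coordinates and by
    conj F on the others: this is why complex isomorphisms preserve
    orientation. *)
Lemma det_with_conj_complex (c : K) (F : 'M[K]_n) :
  \det (with_conj (row_mx F (c *: F))) = \det F * cj (\det F) * (cj c - c) ^+ n.
Proof.
have -> : with_conj (row_mx F (c *: F)) =
    block_mx F 0 0 (map_mx cj F) *m block_mx 1%:M c%:M 1%:M (cj c)%:M.
  rewrite /with_conj map_row_mx map_mxZ mulmx_block !mul0mx !mulmx1.
  rewrite !add0r !addr0.
  by rewrite !mul_mx_scalar.
by rewrite det_mulmx det_lblock det_map_mx det_one_conj.
Qed.

Lemma det_with_conj_real (c : K) (A : 'M[K]_n) : map_mx cj A = A ->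
  \det (with_conj (row_mx A c%:M)) = \det A * (cj c - c) ^+ n.
Proof.
move=> cA.
have -> : with_conj (row_mx A c%:M) =
    block_mx 1%:M c%:M 1%:M (cj c)%:M *m block_mx A 0 0 1%:M.
  rewrite /with_conj map_row_mx map_scalar_mx cA mulmx_block !mulmx0 !mulmx1.
  by rewrite !mul1mx !add0r !addr0.
by rewrite det_mulmx det_ublock det_one_conj det1 mulr1 mulrC.
Qed.
End WithConj.

(** * From interleaved frames to frames in two blocks *)

Section Reindex.

Lemma det_mxsub_bij (K : comNzRingType) (N N' : nat) (t : 'I_N' -> 'I_N)
  (M : 'M[K]_N) : bijective t -> \det (mxsub t t M) = \det M.
Proof.
move=> tb; have /esym := bij_eq_card tb; rewrite !card_ord => NN.
subst N'; have ti := bij_inj tb.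
have -> : mxsub t t M = row_perm (perm ti) (col_perm (perm ti) M).
  by apply/matrixP=> a b; rewrite !mxE !permE.
rewrite row_permE col_permE !det_mulmx !det_perm mulrCA odd_permV.
by rewrite -signr_addb addbb mulr1.
Qed.

Definition block_frame (n : nat) (V : Type) (x y : 'I_n -> V)
  (j : 'I_(n + n)) : V :=
  match fintype.split j with inl k => x k | inr k => y k end.

Lemma block_frame_lshift n V (x y : 'I_n -> V) k :
  block_frame x y (lshift n k) = x k.
Proof. by rewrite /block_frame (unsplitK (inl k)). Qed.

Lemma block_frame_rshift n V (x y : 'I_n -> V) k :
  block_frame x y (rshift n k) = y k.
Proof. by rewrite /block_frame (unsplitK (inr k)). Qed.

Lemma even_lt n (k : 'I_n) : (k.*2 < n.*2)%N.
Proof. by rewrite ltn_double. Qed.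

Lemma odd_lt n (k : 'I_n) : (k.*2.+1 < n.*2)%N.
Proof. by rewrite ltn_Sdouble. Qed.

Definition unblock n : 'I_(n + n) -> 'I_n.*2 :=
  block_frame (fun k => Ordinal (even_lt k)) (fun k => Ordinal (odd_lt k)).

Lemma unblock_bij n : bijective (@unblock n).
Proof.
apply: inj_card_bij; last by rewrite !card_ord addnn.
move=> a b; rewrite /unblock -(splitK a) -(splitK b).
case: (fintype.split a) => k; case: (fintype.split b) => l; rewrite /unsplit;
  rewrite ?block_frame_lshift ?block_frame_rshift => /(congr1 val) /=.
- by move/double_inj/val_inj->.
- by move/(congr1 odd); rewrite /= !odd_double.
- by move/(congr1 odd); rewrite /= !odd_double.
- by case=> /double_inj/val_inj->.
Qed.

Lemma interleave_unblock (R : realType) (n m : nat)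
  (x y : 'I_n -> 'cV[Cplx R]_m) j :
  interleave x y (unblock j) = block_frame x y j.
Proof.
rewrite /unblock /interleave -(splitK j).
case: (fintype.split j) => k; rewrite /unsplit.
  rewrite !block_frame_lshift /= odd_double; congr x; apply: val_inj => /=.
  by rewrite doubleK.
rewrite !block_frame_rshift /= odd_double; congr y; apply: val_inj => /=.
exact: uphalf_double.
Qed.

End Reindex.

(** * Topology and order of the complex numbers *)

HB.instance Definition _ (R : realType) :=
  GRing.RMorphism.copy (@ofReal R) (real_complex R : R -> Cplx R).

Definition conjCplx (R : realType) : Cplx R -> Cplx R := @conjc R.
HB.instance Definition _ (R : realType) :=
  GRing.RMorphism.copy (@conjCplx R) (@conjc R : Cplx R -> Cplx R).

(** * Edges and normals at a vertex of a simple polytope *)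

Section Vertex.
Context (R : realType) (n m : nat) (P : simple_polytope R n m).
Context (v : 'cV[R]_n) (i : 'I_n -> 'I_m).
Hypothesis vP : vertex P v.
Hypothesis facets_v : forall j, facet P j v <-> exists k, i k = j.

Definition vertex_normals : 'M[R]_n := rowsub i (normal P)^T.

Lemma vertex_normalsE p (u : 'M[R]_(n, p)) k l :
  (vertex_normals *m u) k l = ((normal P)^T *m u) (i k) l.
Proof. by rewrite /vertex_normals mul_rowsub_mx mxE. Qed.

Lemma dF_add x u j :
  dF P (x + u) j ord0 = dF P x j ord0 + ((normal P)^T *m u) j ord0.
Proof. by rewrite /dF /facet_dist mulmxDr !mxE addrAC. Qed.

Lemma dF_vertex_facet k : dF P v (i k) ord0 = 0.
Proof. by have [_ ->] : facet P (i k) v by apply/facets_v; exists k. Qed.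

Lemma dF_vertex_gt0 j : ~ (exists k, i k = j) -> 0 < dF P v j ord0.
Proof.
move=> nj; have [Pv _] := vP; rewrite lt_neqAle Pv andbT eq_sym.
by apply/eqP => d0; apply: nj; apply/facets_v.
Qed.

(** The inequalities that are strict at v remain true on a segment around v in
    the direction u: t^-1 bounds |a_j u| / d_j(v) for all these j at once. *)
Lemma small_step (u : 'cV[R]_n) : exists2 t : R, 0 < t &
  forall j, ~ (exists k, i k = j) ->
    `|t * ((normal P)^T *m u) j ord0| <= dF P v j ord0.
Proof.
(* t = 1 / (1 + sum_j r_j) *)
pose r j := `|((normal P)^T *m u) j ord0| / dF P v j ord0.
have r0 j : 0 <= r j by rewrite divr_ge0//; have [+ _] := vP; apply.
have s0 : 0 < 1 + \sum_j r j by rewrite ltr_wpDr// sumr_ge0.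
exists (1 + \sum_j r j)^-1; first by rewrite invr_gt0.
move=> j /dF_vertex_gt0 dj; rewrite normrM ger0_norm ?invr_ge0 ?(ltW s0)//.
rewrite mulrC ler_pdivrMr// mulrC -ler_pdivrMr//.
by rewrite -/(r j) (bigD1 j)//= addrCA lerDl addr_ge0// sumr_ge0.
Qed.

Lemma vertex_step (u : 'cV[R]_n) :
  (forall k, 0 <= (vertex_normals *m u) k ord0) ->
  exists2 t : R, 0 < t & polytope P (v + t *: u).
Proof.
move=> u0; have [t t0 tP] := small_step u; exists t => // j.
rewrite dF_add -scalemxAr [X in _ + X]mxE.
have [[k <-]|nj] := pselect (exists k, i k = j).
  by rewrite dF_vertex_facet add0r mulr_ge0 ?(ltW t0)// -vertex_normalsE.
by have := tP j nj; rewrite ler_norml -lerBlDl sub0r => /andP[].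
Qed.

(** Otherwise v would be the midpoint of a segment v - tu, v + tu in P. *)
Lemma vertex_normals_inj (u : 'cV[R]_n) : vertex_normals *m u = 0 -> u = 0.
Proof.
move=> u0; have [t t0 tP] := small_step u.
have a0 k : ((normal P)^T *m u) (i k) ord0 = 0.
  by rewrite -vertex_normalsE u0 mxE.
have Pt : polytope P (v + t *: u) /\ polytope P (v - t *: u).
  split=> j; rewrite dF_add -?mulmxN -?scaleNr -scalemxAr [X in _ + X]mxE;
  (have [[k <-]|nj] := pselect (exists k, i k = j);
    [by rewrite dF_vertex_facet a0 mulr0 addr0
    |have := tP j nj; rewrite ler_norml]).
    by rewrite -lerBlDl sub0r => /andP[].
  by rewrite mulNr subr_ge0 => /andP[].
have [_ ex] := vP; case: Pt => Pt Pt'.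
have /(ex _ _ Pt Pt') : v = 2^-1 *: (v + t *: u + (v - t *: u)).
  rewrite addrACA subrr addr0 -mulr2n -[v *+ 2]scaler_nat scalerA.
  by rewrite mulVf ?scale1r// pnatr_eq0.
move/eqP; rewrite -subr_eq0 opprB addrC addrA subrK -scalerDl scaler_eq0.
by rewrite gt_eqF ?addr_gt0//= => /eqP.
Qed.

Lemma vertex_normals_unit : vertex_normals \in unitmx.
Proof.
rewrite -unitmx_tr unitmxE unitfE; apply/negP => /det0P[w w0 wA].
move/eqP: w0; apply; apply: trmx_inj; rewrite trmx0; apply: vertex_normals_inj.
by rewrite -[vertex_normals]trmxK -trmx_mul wA trmx0.
Qed.

(** A point of P on the k-th edge at v, found from the basis dual to the
    normals. *)
Lemma dual_step k : exists y (t : R), [/\ 0 < t, polytope P y,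
  forall l, l != k -> facet P (i l) y &
  forall l, (vertex_normals *m (y - v)) l ord0 = t *+ (l == k)].
Proof.
pose u := col k (invmx vertex_normals).
have Au l : (vertex_normals *m u) l ord0 = (l == k)%:R.
  rewrite -[u]/(col k _) colE mulmxA mulmxV ?vertex_normals_unit// -colE.
  by rewrite !mxE.
have [l|t t0 Py] := @vertex_step u; first by rewrite Au ler0n.
exists (v + t *: u), t; split=> //.
  move=> l lk; split=> //.
  rewrite dF_add dF_vertex_facet -vertex_normalsE -scalemxAr [LHS]addrC addr0.
  by rewrite mxE Au (negPf lk) mulr0.
by move=> l; rewrite addrC addKr -scalemxAr mxE Au mulr_natr.
Qed.

(** The edge that meets F_{i_k} only in v lies in all the other facets through
    v: it is cut out by facets through v, not including F_{i_k}; if F_{i_l} were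
    missing as well, it would contain points of both the k-th and the l-th edge,
    and could not lie on a line. *)
Lemma edge_face (E : set 'cV[R]_n) k : edge P E ->
  facet P (i k) `&` E = [set v] ->
  forall l y, l != k -> E y -> facet P (i l) y.
Proof.
move=> [[S ->] [x [e [e0 Sx Sxe line]]]] vE l y lk [_ Sy]; apply: Sy.
have Sv : face P S v by have : [set v] v by []; rewrite -vE => -[].
have kS : i k \notin S.
  apply/negP => kS; have toV z : face P S z -> z = v.
    move=> Sz; have : (facet P (i k) `&` face P S) z.
      by split=> //; have [_ /(_ _ kS)] := Sz.
    by rewrite vE.
  move/eqP: e0; apply; apply: (addrI x).
  by rewrite addr0; exact: etrans (toV _ Sxe) (esym (toV _ Sx)).
apply/negPn/negP => lS.
have on_face r z : i r \notin S -> polytope P z ->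
    (forall q, q != r -> facet P (i q) z) -> face P S z.
  move=> rS Pz zF; split=> // j jS; have [_ /(_ j jS)/facets_v[q qj]] := Sv.
  by rewrite -qj; apply: zF; apply/eqP => qr; move: rS; rewrite -qr qj jS.
have [s vs] := line v Sv.
have coord r : i r \notin S -> exists (c t : R), 0 < t /\
    forall q, c * (vertex_normals *m e) q ord0 = t *+ (q == r).
  move=> rS; have [z [t [t0 Pz zF zt]]] := dual_step r.
  have [c zc] := line z (on_face r z rS Pz zF).
  exists (c - s), t; split=> // q.
  rewrite -zt zc vs opprD addrACA subrr add0r -scalerBl -scalemxAr.
  by rewrite [RHS]mxE.
have [c [t [t0 ct]]] := coord _ kS; have [c' [t' [t'0 ct']]] := coord _ lS.
have := ct l; rewrite (negPf lk) => /eqP.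
rewrite mulf_eq0 => /orP[/eqP c0|/eqP a0].
  by have := ct k; rewrite eqxx c0 mul0r => /eqP; rewrite lt_eqF.
by have := ct' l; rewrite eqxx a0 mulr0 => /eqP; rewrite lt_eqF.
Qed.

(** The vectors along the edges are, up to positive factors, the basis dual to
    the normals. *)
Lemma det_edges_gt0 (e : 'M[R]_n) :
  (forall k, exists E, [/\ edge P E, facet P (i k) `&` E = [set v],
     col k e != 0 & E (v + col k e)]) ->
  0 < \det (vertex_normals *m e).
Proof.
move=> edges.
have entry k l : (vertex_normals *m e) l k =
    dF P (v + col k e) (i l) ord0.
  rewrite dF_add dF_vertex_facet add0r -vertex_normalsE.
  by rewrite colE mulmxA -colE [RHS]mxE.
have -> : vertex_normals *m e =
    diag_mx (\row_k dF P (v + col k e) (i k) ord0).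
  apply/matrixP => l k; rewrite entry [RHS]mxE [X in X *+ _]mxE.
  have [->|lk] := eqVneq l k.
    by rewrite mulr1n.
  have [E [Ee Ev _ Ek]] := edges k.
  by have [_ ->] := edge_face Ee Ev lk Ek; rewrite mulr0n.
rewrite det_diag; apply: prodr_gt0 => k _; rewrite mxE.
have [E [[[S ES] _] Ev ek0 Ek]] := edges k.
have Pk : polytope P (v + col k e) by move: Ek; rewrite ES => -[].
rewrite lt_neqAle Pk andbT eq_sym; apply/eqP => d0.
have : (facet P (i k) `&` E) (v + col k e) by [].
rewrite Ev => /eqP; rewrite -subr_eq0 addrC addKr; exact/negP.
Qed.
End Vertex.

(** * Characteristic vectors at a vertex *)

Section Lambda.
Context (R : realType) (n m : nat) (X : model R n m).
Lemma det_lambda_neq0 (v : 'cV[R]_n) (i : 'I_n -> 'I_m) :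
  injective i -> (forall k, facet (base X) (i k) v) -> polytope (base X) v ->
  \det (\matrix_(j, k) lambda X j (i k)) != 0.
Proof.
move=> i_inj fv Pv; rewrite -det_tr; apply/negP => /det0P[w w0 wA].
move/eqP: w0; apply; apply/rowP => k; rewrite mxE.
pose S := [set i k | k in 'I_n]%SET.
have Sv : face (base X) S !=set0.
  by exists v; split => // j /imsetP[r _ ->].
(* the relation w, indexed by facets *)
pose c j := \sum_(k | i k == j) w ord0 k.
have ci r : c (i r) = w ord0 r.
  by rewrite /c (eq_bigl (pred1 r)) ?big_pred1_eq// => r'; rewrite inj_eq.
rewrite -ci; apply: (lambda_indep Sv); last exact: imset_f.
rewrite big_imset/=; last by move=> ? ? _ _ /i_inj.
apply/colP => j; rewrite summxE [RHS]mxE; move/rowP: wA => /(_ j).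
rewrite mxE [RHS]mxE => wA; rewrite -[RHS]wA.
by apply: eq_bigr => r _; rewrite ci !mxE.
Qed.
End Lambda.

Section Continuity.

Lemma cvg_det (K : numFieldType) (n : nat) (T : Type) (F : set_system T)
  (M : T -> 'M[K]_n) (M0 : 'M[K]_n) : Filter F ->
  (forall a b, M t a b @[t --> F] --> M0 a b) ->
  \det (M t) @[t --> F] --> \det M0.
Proof.
move=> FF cM; rewrite /determinant.
apply: cvg_big => [|s _]; first exact: add_continuous.
apply: cvgM; first exact: cvg_cst.
by apply: cvg_big => [|k _]; [exact: mul_continuous | exact: cM].
Qed.

Lemma norm_conjCplx (R : realType) (x : Cplx R) : `|conjCplx x| = `|x|.
Proof. by case: x => a b; rewrite !normc_def /= sqrrN. Qed.

Lemma cvg_conjCplx (R : realType) (T : Type) (F : set_system T)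
  (f : T -> Cplx R) l :
  Filter F -> f t @[t --> F] --> l -> conjCplx (f t) @[t --> F] --> conjCplx l.
Proof.
move=> FF fl; apply/cvgrPdist_lt => e e0.
move/cvgrPdist_lt : fl => /(_ e e0); apply: filterS => t.
by rewrite -rmorphB norm_conjCplx.
Qed.

Lemma ofReal_gt0 (R : realType) (a : R) : (0 < ofReal a) = (0 < a).
Proof. exact: ltcR. Qed.

Lemma ofReal_ge0 (R : realType) (a : R) : (0 <= ofReal a) = (0 <= a).
Proof. exact: lecR. Qed.

Lemma ge0_ofReal (R : realType) (x : Cplx R) :
  0 <= x -> exists2 a : R, 0 <= a & x = ofReal a.
Proof.
case: x => a b; rewrite lecE /= => /andP[/eqP -> a0].
by exists a.
Qed.

End Continuity.

(** * Points of W(P) over the interior of P *)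

Section Orbifold.
Context (R : realType) (n m : nat) (X : model R n m).
Let P := base X.
Let C := Cplx R.

Lemma cis0 : cis (2 * pi * 0 : R) = 1.
Proof. by rewrite mulr0 /cis cos0 sin0. Qed.

Lemma int_point0 p : int_point X p 0 = map_mx (@ofReal R) (dF P p).
Proof.
by apply/colP => j; rewrite [LHS]mxE [X in cis (_ * X)]mxE cis0 mulr1 [RHS]mxE.
Qed.

Lemma WP_int_point p : polytope P p -> WP X (int_point X p 0).
Proof.
move=> Pp; exists p; split => // j; rewrite int_point0 mxE => d0.
split=> //; exact: (fmorph_inj (@ofReal R)) (etrans d0 (esym (rmorph0 _))).
Qed.

(** The points over the segment from v to a point of the interior converge to
    the point over v. *)
Lemma interior_near v (U : set 'cV[C]_m) : polytope P v ->
  nbhs (int_point X v 0) U ->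
  exists2 p, (forall j, 0 < dF P p j ord0) & U (int_point X p 0).
Proof.
move=> Pv /nbhs_ballP[e /= e0 eU]; have [p0 p0P] := polytope_fulldim P.
have [d _ e'E] := ge0_ofReal (ltW e0).
have [N N0 NE] :=
  ge0_ofReal (normr_ge0 (map_mx (@ofReal R) (dF P p0 - dF P v))).
have d0 : 0 < d by rewrite -ofReal_gt0 -e'E.
have s0 : 0 < 1 + N + d by rewrite addr_gt0// ltr_wpDr.
pose t := d / (1 + N + d).
have t0 : 0 < t by rewrite divr_gt0.
have t1 : t < 1 by rewrite ltr_pdivrMr// mul1r ltrDr ltr_wpDr.
have dFt : dF P (v + t *: (p0 - v)) = dF P v + t *: (dF P p0 - dF P v).
  rewrite /dF /facet_dist mulmxDr -scalemxAr mulmxBr opprD addrACA subrr.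
  by rewrite addr0 addrAC.
exists (v + t *: (p0 - v)).
  move=> j; rewrite dFt; have := Pv j; have := p0P j; rewrite -!/(dF P _).
  move: (dF P p0) (dF P v) => a b a0 b0; rewrite !mxE.
  rewrite (_ : _ + _ = (1 - t) * b j ord0 + t * a j ord0); last by ring.
  apply: ltr_wpDl; last by apply: mulr_gt0.
  by apply: mulr_ge0 => //; rewrite subr_ge0 ltW.
apply: eU; rewrite -ball_normE /= !int_point0 dFt.
move: (dF P p0) (dF P v) NE => a b NE; rewrite map_mxD opprD addrA subrr.
rewrite sub0r normrN map_mxZ normrZ NE e'E ger0_norm ?ofReal_ge0 ?ltW//.
rewrite -rmorphM ltcR /t mulrAC ltr_pdivrMr// ltr_pM2l// addrAC ltrDr.
by rewrite addr_gt0.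
Qed.

Lemma vert0 z : vert X z 0.
Proof.
exists 0, 0; split; first by rewrite mulmx0.
  by move=> u; rewrite mulmx0.
by apply/colP => j; rewrite !mxE mulr0 !rmorph0 mulr0 addr0 mulr0.
Qed.

Lemma J_positive_block (J : 'cV[C]_m -> 'cV[C]_m -> 'cV[C]_m) z x y :
  J_positive X J z (interleave x y) ->
  exists (w : 'I_n -> 'cV[C]_m) (M : 'M[R]_(n + n)), 0 < \det M /\
    forall j, vert X z (block_frame x y j -
      \sum_k ofReal (M k j) *: block_frame w (fun k => J z (w k)) k).
Proof.
move=> [w [M [_ Mx M0]]]; have ub := unblock_bij n.
exists w, (mxsub (@unblock n) (@unblock n) M); split.
  by rewrite det_mxsub_bij.
move=> j; have := Mx (unblock j); rewrite interleave_unblock.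
rewrite (reindex (@unblock n)) /=; last exact: onW_bij.
congr (vert X z (_ - _)); apply: eq_bigr => k _.
by rewrite interleave_unblock mxE.
Qed.

End Orbifold.

(** * The section of the tangent bundle given by a reduction *)

Section Reduction.
Context (R : realType) (n m : nat) (X : model R n m).
Local Notation C := (Cplx R).
Context (J : 'cV[C]_m -> 'cV[C]_m -> 'cV[C]_m).
Context (Theta : 'cV[C]_m -> 'cV[C]_m -> 'cV[R]_((m - n).*2) -> 'cV[C]_m).
Context (Phi : 'cV[C]_m -> 'cV[C]_m -> 'cV[C]_(m - n) -> 'cV[C]_m).
Hypotheses (splitting : real_splitting X Theta) (PhiC : complex_iso X J Phi).
Hypothesis (compat : compatible X Theta Phi).

Definition lift z w := Phi z w 0.

Lemma lift_linear z a w w' : WP X z ->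
  lift z (ofReal a *: w + w') = ofReal a *: lift z w + lift z w'.
Proof.
move=> zW; have := ts_linear PhiC.1 a w w' 0 0 zW.
by rewrite scaler0 addr0.
Qed.

Lemma lift_vert z w : WP X z -> vert X z w -> lift z w = 0.
Proof. by move=> zW zw; apply/(ts_ker PhiC.1). Qed.

Lemma lift_J z w : WP X z -> lift z (J z w) = imI R *: lift z w.
Proof. by move=> zW; rewrite -PhiC.2// scaler0. Qed.

(** Phi and the splitting Theta agree on TX, because an isomorphism of the
    complements fixes their zero sections. *)
Lemma lift_section z w : WP X z -> vert X z (lift z w - w).
Proof.
move=> zW; have [phi phiP PT] := compat; rewrite /lift PT//.
have -> : phi z 0 = 0.
  have := ti_linear phiP 1 0 0 zW; rewrite scaler0 addr0 scale1r => /eqP.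
  by rewrite addrC -subr_eq subrr eq_sym => /eqP.
exact: splitting.2.
Qed.

Lemma lift0 z : WP X z -> lift z 0 = 0.
Proof. by move=> zW; apply: lift_vert => //; exact: vert0. Qed.

Lemma lift_add z w w' : WP X z -> lift z (w + w') = lift z w + lift z w'.
Proof.
by move=> zW; have := lift_linear 1 w w' zW; rewrite rmorph1 !scale1r.
Qed.

Lemma lift_sum z I (r : seq I) (c : I -> R) (f : I -> 'cV[C]_m) : WP X z ->
  lift z (\sum_(k <- r) ofReal (c k) *: f k) =
  \sum_(k <- r) ofReal (c k) *: lift z (f k).
Proof.
move=> zW; elim: r => [|k r IH]; first by rewrite !big_nil lift0.
by rewrite !big_cons lift_linear// IH.
Qed.

Lemma cvg_lift z w j : WP X z ->
  lift x w j ord0 @[x --> within (WP X) (nbhs z)] --> lift z w j ord0.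
Proof.
move=> zW; apply: (@cvg_comp _ _ _ (fun x => lift x w) (fun y => y j ord0)).
  have /subspace_continuousP/(_ (z, w, 0)) cont := ts_cont PhiC.1.
  move=> U /(cont (conj (conj zW I) I)).
  move=> [[A B] [[[A1 A2] [zA1 wA2] A12] B0] AB].
  apply: filterS zA1 => x xA1 xW.
  apply: (AB (x, w, 0)) => //; split; last exact: nbhs_singleton B0.
  by apply: A12; split=> //; exact: nbhs_singleton wA2.
exact: coord_continuous.
Qed.

Context (i : 'I_n -> 'I_m).

Definition lift_mx z p (f : 'I_p -> 'cV[C]_m) : 'M[C]_(n, p) :=
  \matrix_(l, j) lift z (f j) (i l) ord0.

Lemma lift_mx_mul z p q (f : 'I_p -> 'cV[C]_m) (g : 'I_q -> 'cV[C]_m)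
  (M : 'M[R]_(q, p)) : WP X z ->
  (forall j, vert X z (f j - \sum_k ofReal (M k j) *: g k)) ->
  lift_mx z f = lift_mx z g *m map_mx (@ofReal R) M.
Proof.
move=> zW fM; apply/matrixP => l j; rewrite !mxE.
rewrite -[f j](subrK (\sum_k ofReal (M k j) *: g k)) lift_add// lift_vert//.
rewrite add0r lift_sum// summxE; apply: eq_bigr => k _.
by rewrite !mxE mulrC.
Qed.

Lemma lift_mx_block z (x y : 'I_n -> 'cV[C]_m) :
  lift_mx z (block_frame x y) = row_mx (lift_mx z x) (lift_mx z y).
Proof.
apply/matrixP => l j; rewrite -(splitK j); case: (fintype.split j) => k;
  rewrite /unsplit.
  by rewrite row_mxEl !mxE block_frame_lshift.
by rewrite row_mxEr !mxE block_frame_rshift.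
Qed.

End Reduction.

(** * Orientations near a vertex *)

Section VertexOrientation.
Context (R : realType) (n m : nat) (X : model R n m).
Let P := base X.
Local Notation C := (Cplx R).
Context (v : 'cV[R]_n) (i : 'I_n -> 'I_m).
Hypotheses (i_inj : injective i) (fv : forall k, facet P (i k) v).

Definition coord_dir (k : 'I_n) : 'cV[C]_m := imI R *: delta_mx (i k) ord0.

(** The columns lift those of L D to R^m, L having the columns lambda_(i_k),
    using only the coordinates of the facets through v. *)
Definition torus_lift (D : 'M[R]_n) : 'M[R]_(m, n) :=
  (\matrix_(j, k) (j == i k)%:R) *m D.

Lemma torus_liftE D l j : torus_lift D j l = \sum_k (j == i k)%:R * D k l.
Proof. by rewrite mxE; apply: eq_bigr => k _; rewrite mxE. Qed.

Lemma lambdaR_torus_lift D :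
  lambdaR X *m torus_lift D = (\matrix_(j, k) (lambda X j (i k))%:~R) *m D.
Proof.
rewrite /torus_lift mulmxA; congr (_ *m _); apply/matrixP => j k; rewrite !mxE.
rewrite (bigD1 (i k)) //= !mxE eqxx mulr1 big1 ?addr0// => l lk.
by rewrite !mxE (negPf lk) mulr0.
Qed.

Definition dir_mx (p : 'cV[R]_n) (D : 'M[R]_n) : 'M[R]_(n + n) :=
  block_mx 1%:M 0 0 (diag_mx (\row_k (2 * pi * dF P p (i k) ord0)) *m D).

(** Tangent vectors to the torus at z are sqrt(-1) z_j times coordinate vectors;
    over p the factors z_j = d_j(p) of the facets through v are positive, and
    they tend to 0 when p tends to v, so they are kept in a separate matrix. *)
Lemma dir_block (p : 'cV[R]_n) (e D : 'M[R]_n) j :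
  block_frame (fun k => dir_polytope X 0 (col k e))
    (fun k => dir_torus X p 0 (col k (torus_lift D))) j =
  \sum_k ofReal (dir_mx p D k j) *:
    block_frame (fun k => dir_polytope X 0 (col k e)) coord_dir k.
Proof.
rewrite big_split_ord /= -(splitK j); case: (fintype.split j) => l;
  rewrite /unsplit ?block_frame_lshift ?block_frame_rshift.
  rewrite [X in _ + X]big1 ?addr0.
    rewrite (bigD1 l) //= big1 ?addr0.
      by rewrite block_mxEul mxE eqxx rmorph1 scale1r block_frame_lshift.
    by move=> k kl; rewrite block_mxEul mxE (negPf kl) rmorph0 scale0r.
  by move=> k _; rewrite block_mxEdl mxE rmorph0 scale0r.
rewrite [X in X + _]big1 ?add0r; last first.
  by move=> k _; rewrite block_mxEur mxE rmorph0 scale0r.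
apply/colP => j'; rewrite summxE mxE int_point0.
rewrite [X in imI R * X * _](_ : _ =
  ofReal (2 * pi * \sum_k (j' == i k)%:R * D k l)); last first.
  by rewrite [X in ofReal (_ * X)]mxE torus_liftE.
rewrite mulr_sumr rmorph_sum mulr_sumr mulr_suml.
apply: eq_bigr => k _; rewrite block_frame_rshift block_mxEdr mul_diag_mx.
rewrite /coord_dir; move: (dF P p) => d; rewrite !mxE.
have [->|] := eqVneq j' (i k).
  by rewrite mul1r mulr1 !rmorphM; ring.
by move=> _; rewrite !(mul0r, mulr0, rmorph0).
Qed.

Lemma vert_vertex w k : vert X (int_point X v 0) w -> w (i k) ord0 = 0.
Proof.
move=> [k' [w' [_ _ ->]]]; rewrite mxE int_point0 mxE.
by have [_ ->] := fv k; rewrite rmorph0 mul0r.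
Qed.

Context (J : 'cV[C]_m -> 'cV[C]_m -> 'cV[C]_m).
Context (Theta : 'cV[C]_m -> 'cV[C]_m -> 'cV[R]_((m - n).*2) -> 'cV[C]_m).
Context (Phi : 'cV[C]_m -> 'cV[C]_m -> 'cV[C]_(m - n) -> 'cV[C]_m).
Hypotheses (splitting : real_splitting X Theta) (PhiC : complex_iso X J Phi).
Hypothesis (compat : compatible X Theta Phi).
Hypothesis (Pv : polytope P v).

(** Over v the coordinates of the facets through v vanish on the tangent space
    of the orbit, so they do not see the difference between w and its lift. *)
Lemma lift_mx_vertex q (f : 'I_q -> 'cV[C]_m) :
  lift_mx Phi i (int_point X v 0) f = \matrix_(l, j) f j (i l) ord0.
Proof.
apply/matrixP => l j; rewrite !mxE; apply/eqP; rewrite -subr_eq0; apply/eqP.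
have := vert_vertex l (lift_section splitting compat (f j) (WP_int_point Pv)).
by rewrite !mxE.
Qed.

Definition edge_frame (e : 'M[R]_n) : 'I_(n + n) -> 'cV[C]_m :=
  block_frame (fun k => dir_polytope X 0 (col k e)) coord_dir.

Lemma lift_mx_edge_frame (e : 'M[R]_n) :
  lift_mx Phi i (int_point X v 0) (edge_frame e) =
  row_mx (map_mx (@ofReal R) (vertex_normals P i *m e)) (imI R)%:M.
Proof.
rewrite /edge_frame lift_mx_block !lift_mx_vertex.
congr row_mx; apply/matrixP => l k.
  rewrite !mxE cis0 mulr1; congr ofReal.
  by apply: eq_bigr => j _; rewrite !mxE.
by rewrite !mxE inj_eq// eqxx andbT mulr_natr.
Qed.

(** The value of the determinant of [with_conj] at the standard positive frame
    of C^n. *)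
Let kappa : C := (conjCplx (imI R) - imI R) ^+ n.

Lemma kappa_neq0 : kappa != 0.
Proof.
rewrite expf_neq0// subr_eq0; apply/eqP => -[] /eqP.
by rewrite eq_sym -subr_eq0 opprK -mulr2n pnatr_eq0.
Qed.

(** The real determinant of the image of a tangent frame in C^n. *)
Definition frame_det z (f : 'I_(n + n) -> 'cV[C]_m) : C :=
  \det (with_conj (@conjCplx R) (lift_mx Phi i z f)) / kappa.

Lemma map_conj_ofReal p q (M : 'M[R]_(p, q)) :
  map_mx (@conjCplx R) (map_mx (@ofReal R) M) = map_mx (@ofReal R) M.
Proof. by apply/matrixP => a b; rewrite !mxE; exact: conjc_real. Qed.

Lemma frame_det_mul z f g (M : 'M[R]_(n + n)) : WP X z ->
  (forall j, vert X z (f j - \sum_k ofReal (M k j) *: g k)) ->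
  frame_det z f = frame_det z g * ofReal (\det M).
Proof.
move=> zW fM; rewrite /frame_det (lift_mx_mul PhiC i zW fM).
by rewrite with_conj_mul ?map_conj_ofReal// det_mulmx det_map_mx mulrAC.
Qed.

Lemma frame_det_complex z (w : 'I_n -> 'cV[C]_m) : WP X z ->
  0 <= frame_det z (block_frame w (fun k => J z (w k))).
Proof.
move=> zW; rewrite /frame_det lift_mx_block.
have -> : lift_mx Phi i z (fun k => J z (w k)) = imI R *: lift_mx Phi i z w.
  by apply/matrixP => l k; rewrite !mxE (lift_J PhiC)// mxE.
by rewrite det_with_conj_complex mulfK ?kappa_neq0//; exact: mulcJ_ge0.
Qed.

Lemma frame_det_edge e : frame_det (int_point X v 0) (edge_frame e) =
  ofReal (\det (vertex_normals P i *m e)).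
Proof.
rewrite /frame_det lift_mx_edge_frame det_with_conj_real ?map_conj_ofReal//.
by rewrite det_map_mx mulfK// kappa_neq0.
Qed.

Lemma cvg_frame_det z f : WP X z ->
  frame_det x f @[x --> within (WP X) (nbhs z)] --> frame_det z f.
Proof.
move=> zW; apply: cvgM; last exact: cvg_cst.
apply: cvg_det => a b; rewrite -(splitK a); case: (fintype.split a) => l;
  rewrite /unsplit.
  rewrite col_mxEu mxE.
  under eq_cvg do rewrite col_mxEu mxE.
  exact: (cvg_lift PhiC).
rewrite col_mxEd 2!mxE.
under eq_cvg do rewrite col_mxEd 2!mxE.
by apply: cvg_conjCplx; exact: (cvg_lift PhiC).
Qed.

(** If det D were negative, the frame of edge directions and standard torus
    directions would have determinant at most 0 over all interior points,
    whereas this determinant tends to a positive number at v. *)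
Lemma torus_orientation oP oN (e D : 'M[R]_n) : induces X oP oN J ->
  positive_basis oP e -> positive_basis oN (lambdaR X *m torus_lift D) ->
  0 < \det (vertex_normals P i *m e) -> 0 <= \det D.
Proof.
move=> JX eP DN e0; rewrite leNgt; apply/negP => D0.
have cvgf := @cvg_frame_det _ (edge_frame e) (WP_int_point Pv).
rewrite frame_det_edge in cvgf.
move/cvgrPdist_lt : cvgf => /(_ (ofReal (\det (vertex_normals P i *m e)))).
rewrite ofReal_gt0 => /(_ e0) /(interior_near Pv)[p p0].
have pW : WP X (int_point X p 0) by apply: WP_int_point => j; exact: ltW.
move=> /(_ pW).
have /J_positive_block[w [M [M0 wM]]] := JX p 0 e (torus_lift D) p0 eP DN.
have xM := frame_det_mul pW wM.
have xD : frame_det (int_point X p 0) (block_frame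
    (fun k => dir_polytope X 0 (col k e))
    (fun k => dir_torus X p 0 (col k (torus_lift D)))) =
    frame_det (int_point X p 0) (edge_frame e) * ofReal (\det (dir_mx p D)).
  apply: frame_det_mul => // j.
  by rewrite dir_block subrr; exact: vert0.
have dirD0 : \det (dir_mx p D) < 0.
  rewrite /dir_mx det_ublock det1 mul1r det_mulmx det_diag nmulr_llt0//.
  apply: prodr_gt0 => k _; rewrite mxE.
  by apply: mulr_gt0; [rewrite mulr_gt0// pi_gt0 | exact: p0].
have : frame_det (int_point X p 0) (edge_frame e) <= 0.
  rewrite -(@nmulr_lge0 _ (ofReal (\det (dir_mx p D)))); last first.
    by rewrite -oppr_gt0 -rmorphN ofReal_gt0 oppr_gt0.
  by rewrite -xD xM mulr_ge0 ?ofReal_ge0 ?(ltW M0)// frame_det_complex.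
move: (frame_det _ _) => h h0.
rewrite ger0_norm; last by rewrite subr_ge0 (le_trans h0)// ofReal_ge0 ltW.
by rewrite gtrBl => /lt_geF; rewrite h0.
Qed.

End VertexOrientation.

Lemma unit_ratio_gt0 (R : realFieldType) (b l : int) :
  b \is a GRing.unit -> l != 0 -> 0 <= (l%:~R)^-1 * b%:~R :> R -> 0 < b^-1 * l.
Proof.
move=> bU l0 bl; have b0 : b != 0 by apply: contraTneq bU => ->; rewrite unitr0.
(* an invertible integer is its own inverse *)
change (0 < b * l); rewrite lt_neqAle eq_sym mulf_neq0//= -(ler0z R) intrM.
have lR0 : l%:~R != 0 :> R by rewrite intr_eq0.
have -> : b%:~R * l%:~R = l%:~R ^+ 2 * (l%:~R^-1 * b%:~R) :> R.
  by rewrite expr2 -mulrA mulVKf// mulrC.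
by apply: mulr_ge0 => //; exact: sqr_ge0.
Qed.

Theorem mainTheorem10 (R : realType) (n m : nat) (X : model R n m)
  (J : 'cV[Cplx R]_m -> 'cV[Cplx R]_m -> 'cV[Cplx R]_m)
  (reduction : reduces_to X J)
  (oP oN : bool) (orientations : induces X oP oN J)
  (v : 'cV[R]_n) (vP : vertex (base X) v)
  (i : 'I_n -> 'I_m) (order_v : positive_order X oP v i)
  (B : 'M[int]_n) (B_basis : B \in unitmx) (B_pos : positive_basis oN B) :
  0 < \det (Lambda_v X B i).
Proof.
case: reduction => _ [T [Phi [splitting PhiC compat]]].
have [i_inj facets_v [e [eP edges]]] := order_v.
have Pv := vP.1.
have fv k : facet (base X) (i k) v by apply/facets_v; exists k.
have e0 := det_edges_gt0 vP facets_v edges.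
pose L := \matrix_(j, k) lambda X j (i k).
pose LR : 'M[R]_n := map_mx intr L; pose BR : 'M[R]_n := map_mx intr B.
have L0 : \det L != 0 by exact: det_lambda_neq0 i_inj fv Pv.
have LRu : LR \in unitmx by rewrite unitmxE unitfE det_map_mx intr_eq0.
have LRD : lambdaR X *m torus_lift i (invmx LR *m BR) = BR.
  rewrite lambdaR_torus_lift (_ : \matrix_(_, _) _ = LR) ?mulKVmx//.
  by apply/matrixP => j k; rewrite !mxE.
have BRpos : positive_basis oN BR.
  rewrite /positive_basis det_map_mx -(rmorph_sign intr) -rmorphM ltr0z.
  exact: B_pos.
have := torus_orientation i_inj fv splitting PhiC compat Pv orientations eP.
move=> /(_ (invmx LR *m BR)); rewrite LRD => /(_ BRpos e0).
rewrite det_mulmx det_inv !det_map_mx => D0.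
rewrite /Lambda_v det_mulmx det_inv -/L.
by apply: (unit_ratio_gt0 _ L0 D0); rewrite -unitmxE.
Qed.
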